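(* Let $0\le n_1<n_2$ be integers, put $N_1=2^{n_1}$ and $N_2=2^{n_2}$, and let $a$ be a real number such that $a/N_1$ is not an integer multiple of $\pi$. Then $$\prod_{j=n_1+1}^{n_2}\left(\frac{2^{j}}{a}\tan\!\left(\frac{a}{2^{j}}\right)\right)^{2^{j-1}}=a^{N_1-N_2}\,2^{-N_1 n_1+N_2 n_2}\,\frac{\left(\sin\frac{a}{N_2}\right)^{N_2}}{\left(\sin\frac{a}{N_1}\right)^{N_1}} .$$ *)

(* Defs.v *)
From HB Require Import structures.
From mathcomp Require Export all_boot all_order all_algebra.
From mathcomp Require Export reals trigo.

(* Main.v *)
Require Import Defs.
From mathcomp Require Import ring.

(** Doubling gives [tan x = 2 sin(x)^2 / sin(2x)].  Hence, with
    [f k = (2^k sin(a/2^k) / a)^(2^k)], the [j]-th factor is [f j / f (j-1)]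
    and the product telescopes to [f n2 / f n1]. *)

Import Order.TTheory GRing.Theory Num.Theory.
Local Open Scope ring_scope.

Lemma sinD_int_pi_eq0 (R : realType) (x : R) (k : int) :
  (sin (x + k%:~R * pi) == 0) = (sin x == 0).
Proof.
have nat_case y n : (sin (y + n%:R * pi) == 0 :> R) = (sin y == 0).
  elim: n => [|n IHn]; first by rewrite mul0r addr0.
  by rewrite -natr1 mulrDl mul1r addrA sinDpi oppr_eq0.
case: k => n; first exact: nat_case.
by rewrite -(nat_case _ n.+1) NegzE mulrNz mulNr subrK.
Qed.

(** Subtracting [k * pi] with [k] the floor of [x / pi] leaves a remainder in [[0, pi)] whose sine
    is still zero; [sin] is positive on the open interval, so the remainder is 0. *)
Lemma sin_eq0_int_pi (R : realType) (x : R) :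
  sin x = 0 -> exists k : int, x = k%:~R * pi.
Proof.
move=> sx0; exists (Num.floor (x / pi)); set k := Num.floor _.
have pi0 : 0 < pi :> R := pi_gt0 R.
have /andP[kx xk] := floor_itv (x / pi).
rewrite ler_pdivlMr // in kx; rewrite ltr_pdivrMr // intrD mulrDl mul1r in xk.
apply/eqP; rewrite eq_le kx andbT leNgt; apply/negP => lt_kx.
have : sin (x - k%:~R * pi) == 0.
  by rewrite -(sinD_int_pi_eq0 _ _ k) subrK sx0.
by rewrite gt_eqF // sin_gt0_pi // subr_gt0 lt_kx ltrBlDl.
Qed.

Lemma sin_half_neq0 (R : realType) (x : R) : sin (x *+ 2) != 0 -> sin x != 0.
Proof. by apply: contraNneq => sx0; rewrite sin_mulr2n sx0 mulr0 mul0rn. Qed.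

(* Holds also when [cos x = 0]: both sides then divide by [0], which gives [0]. *)
Lemma tan_sin_double (R : realType) (x : R) :
  sin x != 0 -> tan x = sin x ^+ 2 *+ 2 / sin (x *+ 2).
Proof.
move=> sx0; rewrite sin_mulr2n /tan.
have [->|cx0] := eqVneq (cos x) 0; first by rewrite mul0r mul0rn invr0 !mulr0.
by field; rewrite cx0 sx0.
Qed.

Lemma divr_exp2S (R : realType) (a : R) (n : nat) :
  (a / 2 ^+ n.+1) *+ 2 = a / 2 ^+ n.
Proof. by rewrite exprS invfM mulrCA -mulr_natl mulVKf ?pnatr_eq0. Qed.

Theorem mainTheorem4 (R : realType) (n1 n2 : nat) (hn : (n1 < n2)%N)
    (N1 N2 : nat) (hN1 : N1 = (2 ^ n1)%N) (hN2 : N2 = (2 ^ n2)%N)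
    (a : R) (ha : forall k : int, a / N1%:R <> k%:~R * pi) :
  \prod_(n1.+1 <= j < n2.+1) (2 ^+ j / a * tan (a / 2 ^+ j)) ^+ (2 ^ j.-1)%N =
  a ^ (N1%:Z - N2%:Z)
    * 2 ^ (- (N1%:Z * n1%:Z) + N2%:Z * n2%:Z)
    * (sin (a / N2%:R) ^+ N2 / sin (a / N1%:R) ^+ N1).
Proof.
have a0 : a != 0.
  by apply/eqP => a0; apply: (ha 0); rewrite a0 !mul0r.
have two0 : 2 != 0 :> R by rewrite pnatr_eq0.
(* The hypothesis on [a / N1] gives the case [k = n1]; each halving of the angle then preserves
   nonvanishing, by the double-angle formula. *)
have sin0 k : (n1 <= k)%N -> sin (a / 2 ^+ k) != 0.
  move=> /subnK <-; elim: (k - n1)%N => [|d IHd].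
    apply/eqP => /sin_eq0_int_pi[m]; rewrite add0n -natrX -hN1; exact: ha.
  by apply: sin_half_neq0; rewrite addSn divr_exp2S.
pose f k := (2 ^+ k * sin (a / 2 ^+ k) / a) ^+ (2 ^ k)%N.
have f0 k : (n1 <= k)%N -> f k != 0.
  by move=> /sin0 s0; rewrite expf_neq0 // !mulf_neq0 ?invr_eq0 // expf_neq0.
(* The shift [j = k.+1] turns the exponent [2 ^ j.-1] into [2 ^ k] and the factor into
   [f k.+1 / f k]. *)
rewrite big_add1 /= (telescope_prodf_eq f) => //
  [|k /andP[/ltnW/f0]//|k /andP[n1k _]].
- rewrite /f -hN1 -hN2 !expfzDr // -!invr_expz -!PoszM -!exprnP.
  rewrite -[2 ^+ n1]natrX -[2 ^+ n2]natrX -hN1 -hN2.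
  (* Swapping the exponents lets [2 ^ (n * N)] be read as [(2 ^ n) ^ N], that is [N ^ N], the power
     of two occurring in [f n]. *)
  rewrite ![(N1 * _)%N]mulnC ![(N2 * _)%N]mulnC !exprM -!natrX -hN1 -hN2.
  rewrite !expr_div_n !exprMn invf_div mulrACA !invfM !natrX; ring.
- have s0 := sin0 _ n1k; have s1 := sin0 _ (leqW n1k).
  (* Since [2 ^ k.+1 = 2 * 2 ^ k], both sides are [2 ^ k]-th powers, and it suffices to compare the
     bases. *)
  rewrite tan_sin_double // divr_exp2S /f expnS exprM -expr_div_n.
  congr (_ ^+ _); rewrite exprS; field.
  by rewrite a0 s0 expf_neq0.
Qed.
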